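(* Let $\lambda=(\lambda_1,\dots,\lambda_l)$ be a partition of length $l$, $(w_l,\dots,w_1)=(\lambda_1,\dots,\lambda_l)+(l-1,\dots,1,0)$, and $N'_{\lambda,1}=\sum_{i=2}^l\lambda_i-l+1$. (i) If $m<N'_{\lambda,1}$ then $\partial_1^m s_\lambda([x_1]-[x_2])=0$. (ii) $\partial_1^{N'_{\lambda,1}}s_\lambda([x_1]-[x_2])=c_\lambda\,s_{(\lambda_1,1^{l-1})}([x_1]-[x_2])$, where $c_\lambda=\dfrac{N'_{\lambda,1}!}{\prod_{i=1}^{l-1}(w_i-1)!}\prod_{1\le i<j\le l-1}(w_j-w_i)$. (iii) If $\mu=(\mu_1,\dots,\mu_{l'})$ is a partition of length $l'\ge l$ with $\mu_i=\lambda_i$ for $2\le i\le l$ and $\mu_i=1$ for $i>l$, then $\partial_1^{N'_{\lambda,1}}s_\mu([x_1]-[x_2])=c_\lambda\,s_{(\mu_1,1^{l'-1})}([x_1]-[x_2])$. (iv) For $m,r\ge1$, $s_{(m,1^{r-1})}([x_1]-[x_2])=(-1)^{r-1}x_1^{m-1}x_2^{r-1}(x_1-x_2)$.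
   Context: For $t=(t_1,t_2,\dots)$ define $p_m(t)$ by $\exp(\sum_{m\ge1}t_mk^m)=\sum_{m\ge0}p_m(t)k^m$, $p_m=0$ for $m<0$; $s_\mu(t)=\det(p_{\mu_i-i+j}(t))_{1\le i,j\le l}$ for a partition $\mu=(\mu_1\ge\dots\ge\mu_l)$. $[x]=(x,x^2/2,x^3/3,\dots)$, so $[x_1]-[x_2]$ has components $(x_1^i-x_2^i)/i$. $\partial_1=\partial/\partial t_1$. $(m,1^{r-1})$ denotes the hook partition $(m,1,\dots,1)$ with $r-1$ ones. *)

(* Defs.v *)
From HB Require Import structures.
From mathcomp Require Import all_boot all_order all_algebra.
Set Implicit Arguments. Unset Strict Implicit. Unset Printing Implicit Defensive.
Import Order.TTheory GRing.Theory Num.Theory.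
Local Open Scope ring_scope.

(* t = (t_1, t_2, ...) is encoded as a function t : nat -> A, component t_i = t i
   (t 0 is ignored). *)

(* p_m(t) = coefficient of k^m in exp(sum_{i>=1} t_i k^i).  Only i <= m and
   exponential terms j <= m contribute to that coefficient, so this is the
   literal truncated expansion  sum_{j=0}^m (1/j!) [k^m] (sum_{i=1}^m t_i k^i)^j. *)
Definition hpoly (A : comUnitRingType) (t : nat -> A) (m : nat) : A :=
  \sum_(j < m.+1)
     (j`!%:R)^-1 * (((\sum_(1 <= i < m.+1) (t i)%:P * 'X^i) : {poly A}) ^+ j)`_m.

Definition hcoef (A : comUnitRingType) (t : nat -> A) (z : int) : A :=
  match z with Posz n => hpoly t n | Negz _ => 0 end.

Definition schur (A : comUnitRingType) (t : nat -> A) (mu : seq nat) : A :=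
  \det (\matrix_(i < size mu, j < size mu)
          hcoef t ((nth 0%N mu i)%:Z - (i : nat)%:Z + (j : nat)%:Z)).

Definition is_partition (mu : seq nat) : bool :=
  sorted geq mu && all (fun x => (0 < x)%N) mu.

Definition hook (m r : nat) : seq nat := m :: nseq r.-1 1%N.

Definition tx (R : fieldType) (x1 x2 : R) (i : nat) : R :=
  (x1 ^+ i - x2 ^+ i) / i%:R.

Definition schur_t1 (R : fieldType) (t : nat -> R) (mu : seq nat) : {poly R} :=
  schur (fun i => if i == 1%N then 'X else (t i)%:P) mu.

Definition D1 (R : fieldType) (m : nat) (mu : seq nat) (t : nat -> R) : R :=
  ((schur_t1 t mu)^`(m)).[t 1%N].

(* N'_{lambda,1} = sum_{i=2}^l lambda_i - l + 1 = sum_{i=2}^l (lambda_i - 1)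
   (parts are positive, so this is exact) *)
Definition Nprime (lam : seq nat) : nat := \sum_(x <- behead lam) (x - 1)%N.

Definition wseq (lam : seq nat) (i : nat) : nat :=
  (nth 0%N lam (size lam - i) + (i - 1))%N.

Definition clam (R : numFieldType) (lam : seq nat) : R :=
  let l := size lam in
  (Nprime lam)`!%:R / (\prod_(1 <= i < l) ((wseq lam i - 1)`!)%:R)
  * \prod_(1 <= i < l) \prod_(i.+1 <= j < l)
        ((wseq lam j)%:R - (wseq lam i)%:R).

(* Main.v *)
(* With c = x1 - x2 and y = t_1 - c, the generating series of the p_n at
   t = [x1] - [x2], t_1 left free, is (1 - x2 k) / (1 - x1 k) * exp (y k), so that
   p_n - x1 p_(n-1) = E_n - x2 E_(n-1) with E_n = y^n / n!.  Subtracting x1 times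
   each column of the Schur determinant from the next one and expanding along the
   first column leaves minors whose entries are y^(r_i + c_j) times a polynomial;
   the minor omitting row i is divisible by y^(N' + lambda_1 - lambda_i + i - 1).
   Hence s_lambda = y^N' * Q, and Q(c) comes from the corner term alone: it is x1^(lambda_1 - 1) (x1 - x2)
   (-x2)^(l - 1) times the determinant of the 1 / (lambda_(i+1) - i + j - 1)!, a
   Vandermonde determinant.  Appending a part 1 does not change that determinant,
   which gives (iii), and also (iv), where N' = 0. *)
Require Import Defs.
From HB Require Import structures.
From mathcomp Require Import all_boot all_order all_fingroup all_algebra.
From mathcomp Require Import ring zify.
Import Order.TTheory GRing.Theory Num.Theory.
Local Open Scope ring_scope.

(** * Newton's recursion for the coefficients of exp(sum t_i k^i) *)

Section Newton.
Variables (A : comUnitRingType) (t : nat -> A).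
Hypothesis natU : forall n, n.+1%:R \is a @GRing.unit A.

Let T m : {poly A} := \sum_(1 <= i < m.+1) (t i)%:P * 'X^i.

Let coefT m k : (T m)`_k = if (0 < k <= m)%N then t k else 0.
Proof.
rewrite /T coef_sum.
under eq_bigr do rewrite coefCM coefXn.
case: ifP => [/andP[k0 km]|nk].
  rewrite (bigD1_seq k) ?iota_uniq //=; last by rewrite mem_index_iota k0.
  rewrite eqxx mulr1 big1 ?addr0 // => i /negPf; rewrite eq_sym => ->.
  by rewrite mulr0.
rewrite big_nat big1 // => i /andP[i0 im]; case: eqP => [ki|_]; last by rewrite mulr0.
by move: nk; rewrite ki i0 -ltnS im.
Qed.

Let coefT_exp_small m j k : (k < j)%N -> (T m ^+ j)`_k = 0.
Proof.
move=> kj; have -> : T m = 'X * \sum_(1 <= i < m.+1) (t i)%:P * 'X^(i.-1).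
  rewrite mulr_sumr; apply: eq_big_nat => i /andP[i0 _].
  by rewrite mulrCA -exprS prednK.
by rewrite exprMn coefXnM kj.
Qed.

Let coefT_exp_stable m m' j k : (k <= m)%N -> (k <= m')%N ->
  (T m ^+ j)`_k = (T m' ^+ j)`_k.
Proof.
elim: j k => [|j IH] k km km'; first by rewrite !expr0.
rewrite !exprS !coefM; apply: eq_bigr => i _.
have ik : (i <= k)%N by rewrite -ltnS.
rewrite !coefT (leq_trans ik km) (leq_trans ik km') IH //;
  exact: leq_trans (leq_subr _ _) _.
Qed.

Let texp m : {poly A} := \sum_(j < m.+1) ((j`!%:R)^-1)%:P * T m ^+ j.

(** [hpoly t n] truncates at its own index; powers [T m ^+ j] with [j > n] start beyond degree [n],
    so one truncation of order [m] serves all [n <= m]. *)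
Let hpoly_coef m n : (n <= m)%N -> hpoly t n = (texp m)`_n.
Proof.
move=> nm; rewrite /hpoly /texp coef_sum.
rewrite -(big_mkord xpredT (fun j => (j`!%:R)^-1 * (T n ^+ j)`_n)).
under [RHS]eq_bigr do rewrite coefCM.
rewrite -(big_mkord xpredT (fun j => (j`!%:R)^-1 * (T m ^+ j)`_n)).
rewrite (@big_cat_nat _ _ _ n.+1 0 m.+1) //=.
rewrite [X in _ + X]big_nat [X in _ + X]big1 ?addr0.
  by apply: eq_bigr => j _; rewrite (coefT_exp_stable n m).
by move=> j /andP[nj _]; rewrite coefT_exp_small ?mulr0.
Qed.

Let factU n : n`!%:R \is a @GRing.unit A.
Proof.
elim: n => [|n IH]; first by rewrite fact0 unitr1.
by rewrite factS natrM unitrM natU.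
Qed.

(** Truncated form of (exp T)' = T' exp T: differentiating shifts the exponential sum down by one,
    so its top term is removed. *)
Let deriv_texp m :
  (texp m.+1)^`() = (T m.+1)^`() * (texp m.+1 - ((m.+1`!%:R)^-1)%:P * T m.+1 ^+ m.+1).
Proof.
rewrite /texp [in RHS]big_ord_recr /= addrK big_ord_recl expr0 derivD.
rewrite mulr1 derivC add0r raddf_sum mulr_sumr; apply: eq_bigr => i _ /=.
rewrite deriv_mulC deriv_exp /= /bump add1n mulrnAr mulrCA -mulrnAr -mulrnAl; congr (_ * (_ * _)).
rewrite -polyCMn -[_ *+ i.+1]mulr_natr factS natrM; congr (_%:P).
by rewrite (invrM (natU i)) ?mulrVK.
Qed.

Lemma hpoly0 : hpoly t 0 = 1.
Proof. by rewrite /hpoly big_ord1 expr0 coefC eqxx mulr1 fact0 invr1. Qed.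

Lemma hpoly_newton n : n.+1%:R * hpoly t n.+1 =
  \sum_(i < n.+1) (i.+1%:R * t i.+1) * hpoly t (n - i).
Proof.
rewrite (hpoly_coef n.+1) // mulr_natl -coef_deriv deriv_texp coefM.
apply: eq_bigr => i _; have ni : (n - i <= n)%N by exact: leq_subr.
rewrite coef_deriv coefT /= ltn_ord mulr_natl; congr (_ * _).
(* The removed term starts in degree [n.+1], beyond the coefficient at [n - i]. *)
by rewrite coefB coefCM coefT_exp_small // mulr0 subr0 -hpoly_coef // ltnW.
Qed.

End Newton.

(* q satisfies the same Newton recursion as the p_n: with S x n the coefficients of
   x k / (1 - x k) * sum_n q_n k^n, this reduces to S b (n+1) - a S b n = b E_n. *)
Lemma hpoly_twopoint (A : comUnitRingType) (t E : nat -> A) (a b z : A) :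
    (forall n, n.+1%:R \is a @GRing.unit A) ->
    (forall i, i.+1%:R * t i.+1 = a ^+ i.+1 - b ^+ i.+1 + (i == 0)%:R * z) ->
    E 0 = 1 -> (forall n, n.+1%:R * E n.+1 = z * E n) ->
  forall n, hpoly t n.+1 = a * hpoly t n + E n.+1 - b * E n.
Proof.
move=> natU tE E0 ES.
pose q := fix q n := if n is m.+1 then a * q m + E m.+1 - b * E m else 1.
have qS n : q n.+1 = a * q n + E n.+1 - b * E n by [].
pose S x n := \sum_(i < n) x ^+ i.+1 * q (n - i.+1)%N.
have SS x n : S x n.+1 = x * q n + x * S x n.
  rewrite /S big_ord_recl expr1 subn1 mulr_sumr; congr (_ + _).
  by apply: eq_bigr => i _; rewrite lift0 exprS mulrA subSS.
have S0 x : S x 0 = 0 by rewrite /S big_ord0.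
have Sb n : S b n.+1 - a * S b n = b * E n.
  elim: n => [|n IH]; first by rewrite SS S0 E0 /= !mulr0 addr0 subr0.
  rewrite SS [S b n.+1 in X in _ - X]SS /=.
  transitivity (b * (E n.+1 - b * E n) + b * (S b n.+1 - a * S b n)); first by ring.
  by rewrite IH; ring.
have qN n : n.+1%:R * q n.+1 = S a n.+1 - S b n.+1 + z * q n.
  elim: n => [|n IH].
    have := ES 0%N; rewrite !SS !S0 /= E0 !mul1r !mulr1 => ->; ring.
  rewrite (qS n.+1) (SS a).
  have -> : S b n.+2 = a * S b n.+1 + b * E n.+1 by rewrite -Sb; ring.
  transitivity (a * (n.+1%:R * q n.+1) + a * q n.+1 + n.+2%:R * E n.+2
                - b * (n.+1%:R * E n.+1) - b * E n.+1).
    by ring.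
  by rewrite IH !ES (qS n); ring.
(* Newton's recursion and the value 1 at index 0 determine the sequence, because each [n.+1] is a
   unit. *)
have hq n : hpoly t n = q n.
  elim/ltn_ind: n => -[|n] IH; first by rewrite hpoly0.
  apply: (mulrI (natU n)); rewrite hpoly_newton // qN /S -sumrB.
  transitivity (\sum_(i < n.+1) (a ^+ i.+1 * q (n - i)%N - b ^+ i.+1 * q (n - i)%N)
       + \sum_(i < n.+1) ((i : nat) == 0%N)%:R * z * q (n - i)%N).
    rewrite -big_split; apply: eq_bigr => i _ /=.
    by rewrite tE IH ?ltnS ?leq_subr //; ring.
  congr (_ + _); rewrite big_ord_recl /= subn0 mul1r big1 ?addr0 // => i _.
  by rewrite !mul0r.
by move=> n; rewrite !hq.
Qed.

(** * Determinants of reciprocal factorials and the constant c_lambda *)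

Lemma det_reindex (R : comPzRingType) n (A : 'M[R]_n) (p : 'S_n) :
  \det (\matrix_(i, j) A (p i) (p j)) = \det A.
Proof.
transitivity (\det (perm_mx p *m A *m perm_mx p^-1%g)).
  rewrite -row_permE -col_permE; congr (\det _).
  by apply/matrixP => i j; rewrite !mxE.
by rewrite !det_mulmx mulrAC -det_mulmx -perm_mxM mulgV perm_mx1 det1 mul1r.
Qed.

Lemma det_row_scale (R : comPzRingType) n (d : 'I_n -> R) (A : 'I_n -> 'I_n -> R) :
  \det (\matrix_(i, j) (d i * A i j)) = \prod_i d i * \det (\matrix_(i, j) A i j).
Proof.
transitivity (\det (diag_mx (\row_i d i) *m \matrix_(i, j) A i j)).
  by congr (\det _); apply/matrixP => i j; rewrite mul_diag_mx !mxE.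
by rewrite det_mulmx det_diag; congr (_ * _); apply: eq_bigr => i _; rewrite mxE.
Qed.

(* The falling factorials are monic of degree 0, 1, 2, ..., so they differ from
   the monomials by a unitriangular change of basis. *)
Lemma det_ffact (R : comNzRingType) n (v : 'I_n -> nat) :
  \det (\matrix_(i < n, j < n) (v i ^_ j)%:R : 'M[R]_n)
  = \prod_(i < n) \prod_(j < n | (i < j)%N) ((v j)%:R - (v i)%:R).
Proof.
pose ff j : {poly R} := \prod_(k < j) ('X - k%:R%:P).
have ff_size j : size (ff j) = j.+1.
  by rewrite size_prod_XsubC /index_enum -enumT size_enum_ord.
have ff_monic j : ff j \is monic by rewrite monic_prod_XsubC.
have ffE m j : (m ^_ j)%:R = (ff j).[m%:R].
  elim: j => [|j IH]; first by rewrite ffactn0 /ff big_ord0 hornerE.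
  rewrite ffactnSr natrM IH /ff big_ord_recr /= hornerM hornerXsubC.
  case: (leqP j m) => [jm|mj]; first by rewrite natrB.
  by rewrite -/(ff j) -IH ffact_small // !mul0r.
pose C := \matrix_(k < n, j < n) (ff j)`_k.
transitivity (\det ((Vandermonde n (\row_j (v j)%:R))^T *m C)).
  congr (\det _); apply/matrixP => i j; rewrite !mxE ffE.
  rewrite (horner_coef_wide (n := n)) ?ff_size //.
  by apply: eq_bigr => k _; rewrite !mxE mulrC.
rewrite det_mulmx det_tr det_Vandermonde -[\det C]det_tr det_trig.
  rewrite [X in _ * X]big1 ?mulr1 => [|i _].
    by apply: eq_bigr => i _; apply: eq_bigr => j _; rewrite !mxE.
  by rewrite !mxE; have /monicP := ff_monic i; rewrite lead_coefE ff_size.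
apply/is_trig_mxP => i j ij; rewrite !mxE nth_default //.
by rewrite ff_size.
Qed.

Definition rfact (R : unitRingType) (z : int) : R :=
  if z is Posz n then (n`!%:R)^-1 else 0.

(** Here [s] is the tail of the partition. The argument is one below the Schur index of the corner
    minor, since at y = 0 only the [rfact R (z - 1)] term of [minor_entry] survives. *)
Definition rfact_det (R : comUnitRingType) (s : seq nat) : R :=
  \det (\matrix_(i < size s, j < size s)
          rfact R ((nth 0%N s i)%:Z - (i.+1)%:Z + (j : nat)%:Z)).

(** The last row becomes (0, ..., 0, 1): its factorials have negative arguments except for the final
    0!. *)
Lemma rfact_det_rcons1 (R : comUnitRingType) (s : seq nat) :
  rfact_det R (rcons s 1%N) = rfact_det R s.
Proof.
rewrite /rfact_det size_rcons (expand_det_row _ ord_max) (bigD1 ord_max) //=.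
rewrite [X in _ + X]big1 ?addr0 => [|j jn]; last first.
  have jlt : (j < size s)%N.
    by rewrite ltn_neqAle -ltnS ltn_ord andbT.
  rewrite mxE nth_rcons ltnn eqxx.
  have -> : 1%:Z - (size s).+1%:Z + (j : nat)%:Z = Negz (size s - j).-1 by lia.
  by rewrite /rfact mul0r.
rewrite mxE nth_rcons ltnn eqxx.
have -> : 1%:Z - (size s).+1%:Z + (size s)%:Z = 0%:Z by lia.
rewrite /rfact fact0 invr1 mul1r /cofactor -signr_odd addnn odd_double mul1r.
congr (\det _); apply/matrixP => i j; rewrite !mxE !lift_max nth_rcons.
by rewrite ltn_ord.
Qed.

(** Reversing rows and columns turns the entries into 1/(v_i - j)!, which is the falling factorial
    [v i ^_ j] divided by v_i!; both vanish for [j > v i]. Here v_i is w_(i+1) - 1. *)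
Lemma rfact_det_prod (R : numFieldType) (s : seq nat) :
  let v (i : 'I_(size s)) := ((nth 0%N s (rev_ord i)).-1 + i)%N in
  all (leq 1) s ->
  rfact_det R s = (\prod_(i < size s) ((v i)`!%:R)^-1) *
    \prod_(i < size s) \prod_(j < size s | (i < j)%N) ((v j)%:R - (v i)%:R).
Proof.
move=> v  /all_nthP s0; rewrite -det_ffact -det_row_scale /rfact_det.
rewrite -[LHS](det_reindex _ _ _ (perm rev_ord_inj)); congr (\det _).
apply/matrixP => i j; rewrite !mxE !permE.
have /(s0 0%N) si : (rev_ord i < size s)%N by exact: ltn_ord.
have -> : (nth 0%N s (rev_ord i))%:Z - (rev_ord i).+1%:Z + (rev_ord j : nat)%:Z
   = (v i)%:Z - (j : nat)%:Z.
  move: si; rewrite /v; case: (nth _ _ _) => [//|w] _ /=.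
  have := ltn_ord i; have := ltn_ord j; lia.
case: (leqP j (v i)) => [jv|vj].
  rewrite subzn // /rfact -(ffact_fact jv) natrM invfM mulrAC mulVf ?mul1r //.
  by rewrite pnatr_eq0 -lt0n ffact_gt0.
rewrite ffact_small // mulr0.
by have -> : (v i)%:Z - (j : nat)%:Z = Negz (j - v i).-1 by lia.
Qed.

Lemma clam_rfact_det (R : numFieldType) (m : nat) (s : seq nat) :
  all (leq 1) s -> clam R (m :: s) = (Nprime (m :: s))`!%:R * rfact_det R s.
Proof.
move=> s0; have wE (i : 'I_(size s)) :
    wseq (m :: s) i.+1 = ((nth 0%N s (rev_ord i)).-1 + i).+1.
  have /(all_nthP 0%N s0) si : (rev_ord i < size s)%N by exact: ltn_ord.
  move: si; rewrite /wseq /= subSS subn1 -(subnSK (ltn_ord i)) /=.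
  by case: (nth _ _ _).
rewrite rfact_det_prod // /clam /= -mulrA; congr (_ * (_ * _)).
  rewrite big_add1 big_mkord prodfV; congr (_^-1).
  by apply: eq_bigr => i _; rewrite wE subn1.
rewrite big_add1 big_mkord; apply: eq_bigr => i _.
rewrite big_add1 /= big_geq_mkord; apply: eq_bigr => j _.
by rewrite !wE -!natr1; ring.
Qed.

(** * Extracting powers of y from determinants and differentiating them away *)

(** The exponents r_i + c_j - s_i of interest may be negative; the row factors [y ^+ s i] on the
    left avoid division. *)
Lemma det_monomial_scale (R : comPzRingType) n (y : R) (F G : 'M[R]_n)
    (s r c : 'I_n -> nat) :
  (forall i j, y ^+ s i * F i j = y ^+ (r i + c j) * G i j) ->
  y ^+ (\sum_i s i) * \det F = y ^+ (\sum_i r i + \sum_j c j) * \det G.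
Proof.
move=> FG.
have FG' : diag_mx (\row_i y ^+ s i) *m F
    = diag_mx (\row_i y ^+ r i) *m (G *m diag_mx (\row_j y ^+ c j)).
  by apply/matrixP => i j; rewrite !mul_diag_mx mul_mx_diag !mxE FG exprD; ring.
have dX (e : 'I_n -> nat) : \det (diag_mx (\row_i y ^+ e i)) = y ^+ (\sum_i e i).
  by rewrite det_diag expr_sum; apply: eq_bigr => i _; rewrite mxE.
by have := congr1 determinant FG'; rewrite !det_mulmx !dX exprD => ->; ring.
Qed.

(** All column subtractions happen at once, through right multiplication by the unitriangular [T]
    with [- a] just above the diagonal. *)
Lemma det_col_sub (R : comNzRingType) n (f : 'I_n.+1 -> nat -> R) (a : R) :
  \det (\matrix_(i < n.+1, j < n.+1) f i j) =
  \det (\matrix_(i < n.+1, j < n.+1)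
          (if j : nat is j'.+1 then f i j'.+1 - a * f i j' else f i 0%N)).
Proof.
pose T : 'M[R]_n.+1 := \matrix_(k, j) ((k == j)%:R - a * (k.+1 == j)%:R).
have detT : \det T = 1.
  rewrite -det_tr det_trig ?big1 // => [i _|].
    by rewrite !mxE eqxx gtn_eqF // mulr0 subr0.
  apply/is_trig_mxP => i j ij; rewrite !mxE.
  by rewrite -val_eqE /= !gtn_eqF ?mulr0 ?subr0 // ltnW.
rewrite -[LHS]mulr1 -detT -det_mulmx; congr (\det _); apply/matrixP => i j.
have pick k : (k < n.+1)%N -> \sum_(m < n.+1) f i m * ((m : nat) == k)%:R = f i k.
  move=> kn; rewrite (bigD1 (Ordinal kn)) //= eqxx mulr1 big1 ?addr0 // => m.
  by rewrite -val_eqE /= => /negPf->; rewrite mulr0.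
rewrite !mxE; under eq_bigr do rewrite !mxE mulrBr -val_eqE /=.
rewrite big_split /= sumrN pick //; case: j => -[|j] jn /=.
  by rewrite big1 ?subr0 // => k _; rewrite !mulr0.
congr (_ - _); under eq_bigr do rewrite eqSS mulrCA.
by rewrite -mulr_sumr pick // ltnW.
Qed.

Lemma derivn_XsubC_expM_lt (R : comNzRingType) (c : R) N m (Q : {poly R}) :
  (m < N)%N -> ((('X - c%:P) ^+ N * Q)^`(m)).[c] = 0.
Proof.
elim: m N Q => [|m IH] [|N] Q // mN.
  by rewrite derivn0 exprS -mulrA hornerM hornerXsubC subrr mul0r.
rewrite derivSn derivM deriv_exp derivXsubC mul1r /=.
set y := 'X - _; rewrite [X in X^`(m)](_ : _ = y ^+ N * (Q *+ N.+1 + y * Q^`())).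
  exact: IH.
by rewrite exprS; ring.
Qed.

(** One derivative turns [y ^+ N.+1 * Q] into [y ^+ N] times a cofactor whose value at [c] is [N.+1]
    times that of [Q]. *)
Lemma derivn_XsubC_expM (R : comNzRingType) (c : R) N (Q : {poly R}) :
  ((('X - c%:P) ^+ N * Q)^`(N)).[c] = N`!%:R * Q.[c].
Proof.
elim: N Q => [|N IH] Q; first by rewrite derivn0 expr0 fact0 !mul1r.
rewrite derivSn derivM deriv_exp derivXsubC mul1r /=.
set y := 'X - _; rewrite [X in X^`(N)](_ : _ = y ^+ N * (Q *+ N.+1 + y * Q^`())).
  rewrite IH hornerD hornerM hornerXsubC subrr mul0r addr0 hornerMn.
  by rewrite mulrnAr -mulrnAl -mulrnA mulnC factS.
by rewrite exprS; ring.
Qed.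

(** * Factoring y^N' out of the Schur polynomial at [x1] - [x2] with t_1 free *)

Section SchurFactor.
Variables (R : numFieldType) (x1 x2 : R).
Let y : {poly R} := 'X - (x1 - x2)%:P.
Let t' (i : nat) : {poly R} := if i == 1%N then 'X else (tx x1 x2 i)%:P.
Let E (n : nat) : {poly R} := (rfact R n)%:P * y ^+ n.
Let zE (z : int) : {poly R} := if z is Posz n then E n else 0.

Let p_rec n : hpoly t' n.+1 = x1%:P * hpoly t' n + E n.+1 - x2%:P * E n.
Proof.
move: n; apply: (@hpoly_twopoint _ t' E _ _ y) => [n|n||n].
- by rewrite -polyC_natr poly_unitE coefC size_polyC pnatr_eq0 unitfE pnatr_eq0.
- case: n => [|n]; rewrite /t' /y /=.
    by rewrite !expr1 !mul1r polyCB addrC subrK.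
  rewrite mul0r addr0 -!polyC_exp -polyCB /tx -polyC_natr -polyCM.
  by rewrite mulrCA mulfV ?mulr1 // pnatr_eq0.
- by rewrite /E /= fact0 invr1 mul1r.
rewrite /E /= factS natrM invfM exprS polyCM -polyC_natr.
rewrite -[y * (_%:P * _)]mulrCA !mulrA -polyCM mulfV ?mul1r ?pnatr_eq0 //.
Qed.

(** The zero conventions extend [p_rec] to all integers; at [z = 0] both sides are 1. *)
Let hcoefE z :
  hcoef t' z - x1%:P * hcoef t' (z - 1) = zE z - x2%:P * zE (z - 1).
Proof.
case: z => [[|n]|n].
- by rewrite /= hpoly0 /E /= fact0 invr1 mul1r expr0 !mulr0.
- have -> : n.+1%:Z - 1 = n%:Z by lia.
  by rewrite /= p_rec; ring.
have -> : Negz n - 1 = Negz n.+1 by lia.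
by rewrite /= !mulr0.
Qed.

(* What remains of E_z - x2 E_(z-1) once y ^ (z - 1) is factored out. *)
Let minor_entry (z : int) : {poly R} :=
  y * (rfact R z)%:P - x2%:P * (rfact R (z - 1))%:P.

(* The factor y ^ i keeps the exponent i + (z - 1) nonnegative. *)
Let zE_scale (i m : nat) (z : int) : (i : int) + (z - 1) = m ->
  y ^+ i * (zE z - x2%:P * zE (z - 1)) = y ^+ m * minor_entry z.
Proof.
rewrite /minor_entry; case: z => [[|n]|n] zm.
- have -> : i = m.+1 by lia.
  by rewrite /= /E /= expr0 polyC0 !mulr0 !subr0 exprSr; ring.
- have {zm}<- : (i + n = m)%N by lia.
  have -> : n.+1%:Z - 1 = n%:Z by lia.
  by rewrite /= /E /= exprD exprS; ring.
have -> : Negz n - 1 = Negz n.+1 by lia.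
by rewrite /= polyC0 !mulr0 subrr !mulr0.
Qed.

Let hpoly_eval m : (hpoly t' m.+1).[x1 - x2] = x1 ^+ m * (x1 - x2).
Proof.
have yc : y.[x1 - x2] = 0 by rewrite hornerXsubC subrr.
have Ec n : (E n.+1).[x1 - x2] = 0 by rewrite hornerM horner_exp yc exprS !mul0r mulr0.
have comb (a b c : R) p q r :
    (a%:P * p + q - b%:P * r).[c] = a * p.[c] + q.[c] - b * r.[c].
  by rewrite !hornerE.
have E0 : (E 0).[x1 - x2] = 1 by rewrite /E /= fact0 invr1 mulr1 hornerC.
elim: m => [|m IH]; rewrite p_rec comb Ec.
  by rewrite hpoly0 E0 hornerC; ring.
by rewrite IH Ec exprS; ring.
Qed.

Let entry (lam : seq nat) (i j : nat) : int := (nth 0%N lam i)%:Z - i%:Z + j%:Z.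

Lemma schur_t1_factor m s : (0 < m)%N -> is_partition (m :: s) ->
  exists2 Q : {poly R},
    schur_t1 (tx x1 x2) (m :: s) = y ^+ Nprime (m :: s) * Q &
    Q.[x1 - x2] = x1 ^+ m.-1 * (x1 - x2) * (- x2) ^+ size s * rfact_det R s.
Proof.
move=> m0 /andP[srt pos]; set lam := m :: s; set n := size s; set N := Nprime lam.
have entryS u i j : entry u i j = entry u i j.+1 - 1.
  by rewrite /entry -(addn1 j) PoszD addrA addrK.
have le_m (i : 'I_n.+1) : (nth 0%N lam i <= m)%N.
  case: i => -[|i] //= ilt; have /allP := order_path_min (rev_trans leq_trans) srt; apply.
  exact: mem_nth.
have sum_s : (\sum_(i < n.+1) nth 0%N lam i = m + (N + n))%N.
  rewrite big_ord_recl /=; congr (_ + _)%N; rewrite /N /Nprime /n /=.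
  have /andP[_] := pos; elim: (s) => [|a u IH] /= => [_|/andP[a0 /IH {}IH]].
    by rewrite big_ord0 big_nil.
  by rewrite big_ord_recl big_cons /= IH; lia.
pose G (i : 'I_n.+1) : 'M[{poly R}]_n := \matrix_(k, j) minor_entry (entry lam (lift i k) j.+1).
(* The surplus over N' of the power of y in the minor omitting row [i], counted from 0. The
   subtraction is exact by [le_m]; [e] is 0 at the first row and positive elsewhere. *)
pose e (i : 'I_n.+1) := (m - nth 0%N lam i + i)%N.
exists (\sum_(i < n.+1) hcoef t' (entry lam i 0%N) * ((-1) ^+ i * (y ^+ e i * \det (G i)))).
  rewrite /schur_t1 /schur -/lam /= -/n -/t'.
  rewrite (det_col_sub _ _ (fun i j => hcoef t' (entry lam i j)) x1%:P).
  rewrite (expand_det_col _ ord0) mulr_sumr; apply: eq_bigr => i _.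
  rewrite mxE [RHS]mulrCA; congr (_ * _).
  rewrite /cofactor addn0 [RHS]mulrCA; congr (_ * _).
  set F := row' _ _.
  (* Row index plus z - 1 equals the part plus [j], so parts serve as row exponents and [j] as
     column exponent. *)
  have scale : y ^+ (\sum_k lift i k) * \det F =
      y ^+ (\sum_k nth 0%N lam (lift i k) + \sum_(j < n) j) * \det (G i).
    apply: det_monomial_scale => k j; rewrite !mxE lift0 /=.
    rewrite (_ : entry lam _ j = entry lam (bump i k) j.+1 - 1) ?hcoefE; last first.
      exact: entryS.
    apply: zE_scale; rewrite /entry; lia.
  have sum_i : (i + \sum_k lift i k = n + \sum_(j < n) j)%N.
    have := big_ord_recr n (fun j : 'I_n.+1 => j : nat) : _ = (_ + _)%N.
    by rewrite (bigD1_ord i) //= [RHS]addnC.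
  have sum_lam : (nth 0 lam i + \sum_k nth 0 lam (lift i k) = m + (N + n))%N.
    by rewrite -sum_s [RHS](bigD1_ord i).
  have y0 : y != 0 by rewrite polyXsubC_eq0.
  apply: (mulfI (expf_neq0 (\sum_k lift i k) y0)); rewrite [LHS]scale !mulrA -!exprD.
  by congr (y ^+ _ * _); have := le_m i; rewrite /e; lia.
(* Evaluation at x1 - x2 sets y = 0, which kills every row but the first. *)
rewrite big_ord_recl hornerD [X in _ + X]horner_sum [X in _ + X]big1 ?addr0 => [|i _].
  have detG : (\det (G ord0)).[x1 - x2] = (- x2) ^+ n * rfact_det R s.
    rewrite -[LHS](det_map_mx (horner_eval (x1 - x2))) /rfact_det -detZ.
    congr (\det _); apply/matrixP => k j.
    rewrite !mxE lift0 /minor_entry -entryS /= horner_evalE !hornerE subrr.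
    by rewrite mul0r add0r mulNr.
  have -> : e ord0 = 0%N by rewrite /e subnn.
  rewrite expr0 !mul1r hornerM detG mulrA; congr (_ * _ * _).
  by rewrite /entry subr0 addr0 /= -[in LHS](prednK m0) hpoly_eval.
rewrite !hornerM [X in _ * (_ * (X * _))](_ : _ = 0) ?mul0r ?mulr0 //.
by rewrite horner_exp hornerXsubC subrr /e lift0 addnS expr0n.
Qed.

End SchurFactor.

(** * Specialising t_1, hooks, and the four statements *)

Lemma hpoly_rmorph (A B : comUnitRingType) (f : {rmorphism A -> B})
    (t : nat -> A) (u : nat -> B) m :
    (forall n, n.+1%:R \is a @GRing.unit A) -> (forall i, f (t i) = u i) ->
  f (hpoly t m) = hpoly u m.
Proof.
move=> natU tu; rewrite /hpoly rmorph_sum; apply: eq_bigr => j _.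
rewrite rmorphM -coef_map rmorphXn rmorph_sum rmorphV ?rmorph_nat.
  congr (_ * nth _ (polyseq (_ ^+ _)) _); apply: eq_bigr => i _.
  by rewrite rmorphM /= map_polyC map_polyXn /= tu.
by rewrite -(prednK (fact_gt0 j)).
Qed.

Lemma schur_t1_eval (R : numFieldType) (t : nat -> R) mu :
  (schur_t1 t mu).[t 1%N] = schur t mu.
Proof.
rewrite /schur_t1 /schur -[LHS](det_map_mx (horner_eval (t 1%N))).
congr (\det _); apply/matrixP => i j; rewrite !mxE.
case: (_ + _) => n /=; last by rewrite horner_evalE horner0.
apply: hpoly_rmorph => [k|k].
  by rewrite -polyC_natr poly_unitE coefC size_polyC pnatr_eq0 unitfE pnatr_eq0.
by rewrite /= horner_evalE; case: eqP => [->|_]; rewrite !hornerE.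
Qed.

Lemma rfact_det_cat1 (R : comUnitRingType) (s : seq nat) k :
  rfact_det R (s ++ nseq k 1%N) = rfact_det R s.
Proof.
elim: k s => [|k IH] s; first by rewrite cats0.
by rewrite -cat_rcons IH rfact_det_rcons1.
Qed.

(** For a hook N' = 0, so the Schur value is Q(x1 - x2), with the determinant of an all-ones tail
    reduced to the empty one. *)
Lemma schur_hook_twopoint (R : numFieldType) (x1 x2 : R) m k : (0 < m)%N ->
  schur (tx x1 x2) (hook m k.+1) = x1 ^+ m.-1 * (x1 - x2) * (- x2) ^+ k.
Proof.
move=> m0; rewrite -schur_t1_eval /hook /=.
have partP : is_partition (m :: nseq k 1%N).
  rewrite /is_partition /= m0 all_nseq orbT andbT.
  by elim: k m m0 => //= k IH m ->; exact: IH.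
have [Q -> Qc] := schur_t1_factor _ x1 x2 _ _ m0 partP.
have -> : Nprime (m :: nseq k 1%N) = 0%N.
  by rewrite /Nprime /= big_seq big1 // => i /nseqP[-> _].
rewrite mul1r /tx !expr1 divr1 Qc size_nseq -[nseq k _]cat0s rfact_det_cat1.
by rewrite /rfact_det det_mx00 mulr1.
Qed.

(** The derivative is N'! Q(x1 - x2), and the factors of Q(x1 - x2) other than [rfact_det R s] form
    the hook value. *)
Lemma D1_Nprime (R : numFieldType) (x1 x2 : R) m s : is_partition (m :: s) ->
  D1 (Nprime (m :: s)) (m :: s) (tx x1 x2)
  = (Nprime (m :: s))`!%:R * rfact_det R s
    * schur (tx x1 x2) (hook m (size s).+1).
Proof.
move=> lamP; have /andP[_ /andP[m0 _]] := lamP.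
have [Q QE Qc] := schur_t1_factor _ x1 x2 _ _ m0 lamP.
rewrite /D1 QE {1}/tx !expr1 divr1 derivn_XsubC_expM Qc.
by rewrite schur_hook_twopoint //; ring.
Qed.

Theorem theorem2p4 (R : numFieldType) (x1 x2 : R) :
  (forall lam : seq nat, is_partition lam -> (0 < size lam)%N ->
     let t := tx x1 x2 in
     let l := size lam in
     (* (i) *)
     (forall m : nat, (m < Nprime lam)%N -> D1 m lam t = 0) /\
     (* (ii) *)
     D1 (Nprime lam) lam t = clam R lam * schur t (hook (head 0%N lam) l) /\
     (* (iii) *)
     (forall mu : seq nat, is_partition mu -> (l <= size mu)%N ->
        (forall i : nat, (1 <= i < l)%N -> nth 0%N mu i = nth 0%N lam i) ->
        (forall i : nat, (l <= i < size mu)%N -> nth 0%N mu i = 1%N) ->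
        D1 (Nprime lam) mu t = clam R lam * schur t (hook (head 0%N mu) (size mu))))
  /\
  (* (iv) *)
  (forall m r : nat, (1 <= m)%N -> (1 <= r)%N ->
     schur (tx x1 x2) (hook m r)
     = (-1) ^+ (r - 1) * x1 ^+ (m - 1) * x2 ^+ (r - 1) * (x1 - x2)).
Proof.
split=> [[|m s] lamP // _ t l|m [|k] // m0 _]; last first.
  by rewrite schur_hook_twopoint // !subn1 /= [(- x2) ^+ k]exprNn; ring.
have /andP[_ /andP[m0 s0]] := lamP.
split=> [k kN|].
  have [Q QE _] := schur_t1_factor _ x1 x2 _ _ m0 lamP.
  by rewrite /D1 QE {1}/t /tx !expr1 divr1 derivn_XsubC_expM_lt.
rewrite clam_rfact_det //; split=> [|[|m' u] // muP lu mu_lam mu1].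
  exact: D1_Nprime.
(* The tail of [mu] is that of [lam] followed by ones, which changes neither N' nor [rfact_det]. *)
have uE : u = s ++ nseq (size u - size s) 1%N.
  apply: (@eq_from_nth _ 0%N) => [|i iu].
    by rewrite size_cat size_nseq subnKC.
  rewrite nth_cat; case: ltnP => si; first by have := mu_lam i.+1 si.
  rewrite nth_nseq ltn_sub2r ?(leq_ltn_trans si) //.
  by apply: (mu1 i.+1); rewrite /l /= ltnS si.
have -> : Nprime (m :: s) = Nprime (m' :: u).
  rewrite /Nprime /= uE big_cat /= [X in (_ + X)%N]big_seq.
  by rewrite [X in (_ + X)%N]big1 ?addn0 // => i /nseqP[-> _].
by rewrite D1_Nprime // [in rfact_det R u]uE rfact_det_cat1.
Qed.
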